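(* In the setting below, suppose condition (B) holds: there exist $C>0$, $R>0$ and $M\in\mathbb{N}$ such that for all $r\in(0,R)$ and all integers $m\ge M$, if $\mathbb{P}_X(S_r)>0$ then $$\mathbb{E}\big[|\eta(X^x_m)-\eta(x)|\ \big|\ X^x_m\in S_r\big]\le C\,\mathbb{E}\big[|\eta(X)-\eta(x)|\ \big|\ X\in S_r\big].$$ If $x$ is a Lebesgue point for $\eta$ with respect to $\mathbb{P}_X$, then $\mathbb{E}[|\eta(X^x_m)-\eta(x)|]\to 0$ as $m\to\infty$.
   Context: Let $(\mathcal{X},d)$ be a metric space with its Borel $\sigma$-algebra, let $(\Omega,\mathcal{F},\mathbb{P})$ be a probability space, and let $X,X_1,X_2,\dots$ be i.i.d. $\mathcal{X}$-valued random variables with common law $\mathbb{P}_X$. For $x\in\mathcal{X}$ and $r>0$ write $\bar B_r=\{x':d(x,x')\le r\}$ and $S_r=\{x':d(x,x')=r\}$. The support of $\mathbb{P}_X$ is the set of $x$ such that $\mathbb{P}_X(\bar B_r(x))>0$ for all $r>0$. Fix $x$ in the support of $\mathbb{P}_X$ and a bounded measurable $\eta:\mathcal{X}\to\mathbb{R}$. For each $m\in\mathbb{N}$, a nearest neighbor of $x$ among $X_1,\dots,X_m$ is a measurable $X^x_m:\Omega\to\mathcal{X}$ with $X^x_m(\omega)\in\arg\min_{x'\in\{X_1(\omega),\dots,X_m(\omega)\}}d(x,x')$ for every $\omega\in\Omega$; fix such a sequence $(X^x_m)_{m\in\mathbb{N}}$. Conditional expectations given an event $A$ of positive probability mean $\mathbb{E}[Z\mid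 A]=\mathbb{E}[Z\mathbb{I}_A]/\mathbb{P}(A)$ (note $\mathbb{P}_X(S_r)>0$ iff $\mathbb{P}(X^x_m\in S_r)>0$). The point $x$ is a Lebesgue point if $\mathbb{E}[\mathbb{I}_{\bar B_r}(X)\,|\eta(X)-\eta(x)|]/\mathbb{P}_X(\bar B_r)\to 0$ as $r\to 0^+$. *)

(* Defs.v *)
From HB Require Import structures.
From mathcomp Require Import all_boot all_order all_algebra.
From mathcomp Require Import all_classical all_reals all_analysis.
Set Implicit Arguments. Unset Strict Implicit. Unset Printing Implicit Defensive.
Import Order.TTheory GRing.Theory Num.Theory.
Import numFieldNormedType.Exports.
Local Open Scope classical_set_scope.
Local Open Scope ring_scope.

Definition is_metric {R : realType} {T : Type} (dist : T -> T -> R) : Prop :=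
  (forall x y, 0 <= dist x y) /\
  (forall x y, dist x y = 0 <-> x = y) /\
  (forall x y, dist x y = dist y x) /\
  (forall x y z, dist x z <= dist x y + dist y z).

Definition metric_open {R : realType} {T : Type} (dist : T -> T -> R)
  (A : set T) : Prop :=
  forall y, A y -> exists e : R, 0 < e /\ [set z | dist y z < e] `<=` A.

Definition borel_of_metric {R : realType} {d} {T : measurableType d}
  (dist : T -> T -> R) : Prop :=
  (@measurable d T) = <<s metric_open dist >>.

Definition cball {R : realType} {T : Type} (dist : T -> T -> R) (x : T) (r : R)
  : set T := [set x' | dist x x' <= r].
Definition sphere {R : realType} {T : Type} (dist : T -> T -> R) (x : T) (r : R)
  : set T := [set x' | dist x x' = r].

Definition law {R : realType} {dO} {Omega : measurableType dO} {d} {T : measurableType d}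
  (P : probability Omega R) (Z : Omega -> T) (B : set T) : \bar R :=
  P (Z @^-1` B).

Definition iid {R : realType} {dO} {Omega : measurableType dO} {d} {T : measurableType d}
  (P : probability Omega R) (Y : nat -> Omega -> T) : Prop :=
  (forall i, measurable_fun setT (Y i)) /\
  (forall i (B : set T), measurable B -> law P (Y i) B = law P (Y 0%N) B) /\
  (forall (s : seq nat) (B : nat -> set T), uniq s ->
     (forall i, measurable (B i)) ->
     P (\big[setI/setT]_(i <- s) (Y i @^-1` B i)) =
     (\prod_(i <- s) P (Y i @^-1` B i))%E).

Definition cond_exp {R : realType} {dO} {Omega : measurableType dO}
  (P : probability Omega R) (Z : Omega -> R) (A : set Omega) : R :=
  fine (\int[P]_(w in A) (Z w)%:E) / fine (P A).

Definition in_support {R : realType} {dO} {Omega : measurableType dO} {d}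
  {T : measurableType d} (P : probability Omega R) (X : Omega -> T)
  (dist : T -> T -> R) (x : T) : Prop :=
  forall r : R, 0 < r -> (0 < law P X (cball dist x r))%E.

Definition lebesgue_point {R : realType} {dO} {Omega : measurableType dO} {d}
  {T : measurableType d} (P : probability Omega R) (X : Omega -> T)
  (dist : T -> T -> R) (eta : T -> R) (x : T) : Prop :=
  (fun r : R => fine (\int[P]_(w in X @^-1` cball dist x r)
                        (`|eta (X w) - eta x|)%:E)
                / fine (law P X (cball dist x r))) @ (0 : R)^'+ --> (0 : R).

Definition nearest_neighbor {R : realType} {Omega T : Type}
  (dist : T -> T -> R) (Y : nat -> Omega -> T) (x : T) (m : nat)
  (NN : Omega -> T) : Prop :=
  forall w, (exists2 i, (1 <= i <= m)%N & NN w = Y i w) /\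
            (forall j, (1 <= j <= m)%N -> dist x (NN w) <= dist x (Y j w)).

(* Main.v *)
Require Import Defs.
From HB Require Import structures.
From mathcomp Require Import all_boot all_order all_algebra.
From mathcomp Require Import all_classical all_reals all_analysis.
From mathcomp Require Import measurable_realfun ring lra.
Import Order.TTheory GRing.Theory Num.Theory.
Import numFieldNormedType.Exports.
Local Open Scope classical_set_scope.
Local Open Scope ring_scope.
(** Write [g z = |eta z - eta x|], let [N] be the nearest neighbor among [m]
points, and for a (closed or open) ball [B] around [x] put [f B = P(X \in B)],
[e B = E[g X; X \in B]] and [E B = E[g N; N \in B]]; then
[P(N \notin B) = (1 - f B)^m].  For a shell [J = B' \ B] one has
[P(N \in J) = f J * W], where [W] is a difference quotient of [t |-> t^m], hence
decreases from one shell to the next.  Two kinds of shells satisfy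
[E J <= C * W * e J]: spheres of positive mass, by condition (B), and shells of
mass at most [(1 - f B') / m], by a union bound over the index of the nearest
neighbor.  Summation by parts over a chain of such shells, together with
[e B <= eps * f B] for small balls, gives [E B <= C * eps * P(N \in B)].
Phrased as an inequality [ladder_inv] about a single ball, preserved when one
shell is added, the bound is propagated to all radii up to [delta] by real
induction, so that no explicit chain has to be built.  Outside the ball of
radius [delta] the contribution is at most [K * (1 - f B)^m], which vanishes as
[m] grows because [x] is in the support. *)

(** * Difference quotients of [t^m] and summation by parts *)

Section ladder.
Context {R : realType}.
Implicit Types a b C eps : R.

(** The difference quotient of [t^m] between [b] and [a], written as a sum so that it keeps its
    meaning at [a = b]. *)
Definition slope (m : nat) a b : R := \sum_(i < m) a ^+ (m.-1 - i) * b ^+ i.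

Lemma slopeE m a b : a ^+ m - b ^+ m = (a - b) * slope m a b.
Proof. by rewrite subrXX. Qed.

Lemma slope_ge m a b : 0 <= b -> b <= a -> m%:R * b ^+ m.-1 <= slope m a b.
Proof.
move=> b0 ba; have -> : m%:R * b ^+ m.-1 = \sum_(i < m) b ^+ (m.-1 - i) * b ^+ i.
  rewrite (eq_bigr (fun=> b ^+ m.-1)); last first.
    by move=> i _; rewrite -exprD subnK// -ltnS prednK// (leq_trans _ (ltn_ord i)).
  by rewrite sumr_const card_ord mulr_natl.
apply: ler_sum => i _; apply: ler_wpM2r; first exact: exprn_ge0.
by apply: lerXn2r; rewrite ?nnegrE//; apply: le_trans ba.
Qed.

Lemma slope_le m a b : 0 <= b -> b <= a -> slope m a b <= m%:R * a ^+ m.-1.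
Proof.
move=> b0 ba; have a0 := le_trans b0 ba.
have -> : m%:R * a ^+ m.-1 = \sum_(i < m) a ^+ (m.-1 - i) * a ^+ i.
  rewrite (eq_bigr (fun=> a ^+ m.-1)); last first.
    by move=> i _; rewrite -exprD subnK// -ltnS prednK// (leq_trans _ (ltn_ord i)).
  by rewrite sumr_const card_ord mulr_natl.
apply: ler_sum => i _; apply: ler_wpM2l; first exact: exprn_ge0.
by apply: lerXn2r; rewrite ?nnegrE.
Qed.

(** The gap condition gives [a <= b * (1 + 1/m) <= b * exp(1/m)], so passing from [b] to [a] costs
    at most a factor [expR 1] in the power [m.-1]. *)
Lemma slope_ge_small_gap m a b : 0 <= b -> b <= a -> a - b <= b / m%:R ->
  m%:R * a ^+ m.-1 <= expR 1 * slope m a b.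
Proof.
move=> b0 ba; case: m => [|m] gap; first by rewrite mul0r /slope big_ord0 mulr0.
apply: (@le_trans _ _ (expR 1 * (m.+1%:R * b ^+ m))); last first.
  by rewrite ler_wpM2l ?expR_ge0//; apply: slope_ge.
rewrite mulrCA ler_wpM2l//=.
have le_a : a <= b * expR (m.+1%:R^-1).
  apply: (@le_trans _ _ (b * (1 + m.+1%:R^-1))); last first.
    by rewrite ler_wpM2l// expR_ge1Dx.
  by rewrite mulrDr mulr1 -lerBlDl.
apply: (@le_trans _ _ ((b * expR (m.+1%:R^-1)) ^+ m)).
  by apply: lerXn2r; rewrite ?nnegrE ?mulr_ge0 ?expR_ge0//; apply: le_trans ba.
rewrite exprMn mulrC ler_wpM2r ?exprn_ge0// -expRM_natl ler_expR.
by rewrite ler_pdivrMr// mul1r ler_nat.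
Qed.

(* One step of a summation by parts: the weight of [eps * f - e] drops from
   [m (1 - f)^(m-1)] to [m (1 - f')^(m-1)], and [slope] lies in between. *)
Lemma ladder_step m C eps (E e f EJ eJ fJ : R) :
  0 <= C -> 0 <= eps -> 0 <= fJ -> f + fJ <= 1 ->
  e <= eps * f -> e + eJ <= eps * (f + fJ) ->
  EJ <= C * slope m (1 - f) (1 - (f + fJ)) * eJ ->
  E + C * (m%:R * (1 - f) ^+ m.-1) * (eps * f - e)
    <= C * eps * (1 - (1 - f) ^+ m) ->
  E + EJ + C * (m%:R * (1 - (f + fJ)) ^+ m.-1) * (eps * (f + fJ) - (e + eJ))
    <= C * eps * (1 - (1 - (f + fJ)) ^+ m).
Proof.
move=> C0 eps0 fJ0 f1 ef ef' EJle inv.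
have b0 : 0 <= 1 - (f + fJ) by lra.
have ba : 1 - (f + fJ) <= 1 - f by lra.
have := slopeE m (1 - f) (1 - (f + fJ)).
have := slope_ge m _ _ b0 ba; have := slope_le m _ _ b0 ba.
move: EJle inv; set W := slope _ _ _; set U := m%:R * _; set V := m%:R * _.
set A := _ ^+ m; set B := _ ^+ m => EJle inv WU VW AB.
have fJW : fJ * W = A - B by rewrite AB; congr (_ * _); ring.
(* The defect [eps * f - e] is nonnegative before and after the shell, so both weights [U] and [V]
   can be exchanged for [W] in the favorable direction. *)
have s1 : 0 <= C * (W - V) * (eps * (f + fJ) - (e + eJ)).
  by rewrite !mulr_ge0 ?subr_ge0.
have s2 : 0 <= C * (U - W) * (eps * f - e) by rewrite !mulr_ge0 ?subr_ge0.
have : C * eps * (1 - B) = C * eps * (1 - A) + C * eps * (fJ * W).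
  by rewrite fJW; ring.
lra.
Qed.

End ladder.

(** * Masses and partial means of a bounded function *)

Section partial_mean.
Context {R : realType} {dO d : measure_display} {Omega : measurableType dO}
  {T : measurableType d} (P : probability Omega R).
Implicit Types (Z : Omega -> T) (g : T -> R) (A B J : set T).

Definition mass Z B : R := fine (law P Z B).

Definition pmean Z g B : R :=
  fine (\int[P]_(w in Z @^-1` B) (g (Z w))%:E).

Lemma preimage_measurable Z B : measurable_fun setT Z -> measurable B ->
  measurable (Z @^-1` B).
Proof. by move=> mZ mB; rewrite -[X in measurable X]setTI; exact: mZ. Qed.

Lemma mass_fin Z B : measurable_fun setT Z -> measurable B ->
  law P Z B = (mass Z B)%:E.
Proof.
by move=> mZ mB; rewrite fineK// fin_num_measure//; exact: preimage_measurable.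
Qed.

Lemma mass_ge0 Z B : 0 <= mass Z B.
Proof. exact: fine_ge0. Qed.

Lemma massT Z : mass Z setT = 1.
Proof. by rewrite /mass /law preimage_setT probability_setT. Qed.

Lemma mass0 Z : mass Z set0 = 0.
Proof. by rewrite /mass /law preimage_set0 measure0. Qed.

Lemma massD Z A B : measurable_fun setT Z -> measurable A -> measurable B ->
  A `<=` B -> mass Z B = mass Z A + mass Z (B `\` A).
Proof.
move=> mZ mA mB AB; apply: EFin_inj.
have mBA := measurableD mB mA.
rewrite EFinD -!mass_fin// -[in LHS](setDUK AB) /law preimage_setU measureU//.
- exact: preimage_measurable.
- exact: preimage_measurable.
- by rewrite -preimage_setI setDIK preimage_set0.
Qed.

Lemma mass_le1 Z B : measurable_fun setT Z -> measurable B -> mass Z B <= 1.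
Proof.
move=> mZ mB; rewrite -(massT Z) (massD _ _ _ mZ mB measurableT (@subsetT _ B)).
by rewrite lerDl mass_ge0.
Qed.

Lemma massC Z B : measurable_fun setT Z -> measurable B ->
  mass Z (~` B) = 1 - mass Z B.
Proof.
move=> mZ mB.
rewrite -(massT Z) (massD _ _ _ mZ mB measurableT (@subsetT _ B)) setTD.
by rewrite addrAC subrr add0r.
Qed.

Section bounded.
Context (Z : Omega -> T) (g : T -> R) (K : R).
Hypotheses (mZ : measurable_fun setT Z) (mg : measurable_fun setT g)
  (g0 : forall z, 0 <= g z) (gK : forall z, g z <= K).

Lemma measurable_pmean (D : set Omega) :
  measurable_fun D (EFin \o (g \o Z)).
Proof.
by apply: measurable_funTS; apply/measurable_EFinP; exact: measurableT_comp.
Qed.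

Lemma le_integral_mass B : measurable B ->
  (\int[P]_(w in Z @^-1` B) (g (Z w))%:E <= (K * mass Z B)%:E)%E.
Proof.
move=> mB; have mZB := preimage_measurable _ _ mZ mB.
rewrite EFinM -mass_fin// -integral_cst//; apply: ge0_le_integral => //.
- by move=> w _; rewrite lee_fin.
- exact: measurable_pmean.
- by move=> w _; rewrite lee_fin.
Qed.

Lemma pmean_fin B : measurable B ->
  (\int[P]_(w in Z @^-1` B) (g (Z w))%:E)%E = (pmean Z g B)%:E.
Proof.
move=> mB; rewrite fineK// ge0_fin_numE; last first.
  by apply: integral_ge0 => w _; rewrite lee_fin.
by apply: le_lt_trans (le_integral_mass _ mB) _; rewrite ltry.
Qed.

Lemma pmean_ge0 B : 0 <= pmean Z g B.
Proof. by apply: fine_ge0; apply: integral_ge0 => w _; rewrite lee_fin. Qed.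

Lemma pmean_le_mass B : measurable B -> pmean Z g B <= K * mass Z B.
Proof. by move=> mB; rewrite -lee_fin -pmean_fin//; exact: le_integral_mass. Qed.

Lemma pmeanD A B : measurable A -> measurable B -> A `<=` B ->
  pmean Z g B = pmean Z g A + pmean Z g (B `\` A).
Proof.
move=> mA mB AB; apply: EFin_inj; have mBA := measurableD mB mA.
rewrite EFinD -!pmean_fin// -[in LHS](setDUK AB) preimage_setU ge0_integral_setU//.
- exact: preimage_measurable.
- exact: preimage_measurable.
- exact: measurable_pmean.
- by move=> w _; rewrite lee_fin.
- by apply/disj_setPS; rewrite -preimage_setI setDIK preimage_set0.
Qed.

Lemma pmean_eq0 B : measurable B -> mass Z B = 0 -> pmean Z g B = 0.
Proof.
move=> mB mass0; apply/eqP; rewrite eq_le pmean_ge0 andbT.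
by rewrite (le_trans (pmean_le_mass _ mB))// mass0 mulr0.
Qed.

End bounded.
End partial_mean.

(** * Product formulas for an i.i.d. sample *)

Section nearest.
Context {R : realType} {dO d : measure_display} {Omega : measurableType dO}
  {T : measurableType d} (P : probability Omega R).
Context (Y : nat -> Omega -> T) (iidY : iid P Y).

Let mY i : measurable_fun setT (Y i).
Proof. by case: iidY. Qed.

Lemma iid_prod (s : seq nat) (V : nat -> set T) : uniq s ->
  (forall j, measurable (V j)) ->
  P (\big[setI/setT]_(j <- s) (Y j @^-1` V j)) =
  (\prod_(j <- s) mass P (Y 0%N) (V j))%:E.
Proof.
case: iidY => _ [sameY indY] us mV; rewrite indY//.
elim: s {us} => [|j s IH]; first by rewrite !big_nil.
rewrite !big_cons IH EFinM; congr (_ * _)%E.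
by rewrite -mass_fin// -(sameY j).
Qed.

Lemma iid_pow (s : seq nat) (V : set T) : uniq s -> measurable V ->
  P (\big[setI/setT]_(j <- s) (Y j @^-1` V)) = (mass P (Y 0%N) V ^+ size s)%:E.
Proof.
move=> us mV; rewrite (iid_prod s (fun=> V))//.
by rewrite big_const_seq count_predT -Monoid.iteropE.
Qed.

Lemma iid_restrict i (s : seq nat) (V A : set T) : uniq (i :: s) ->
  measurable V -> measurable A ->
  P (Y i @^-1` A `&` \big[setI/setT]_(j <- s) (Y j @^-1` V)) =
  ((mass P (Y 0%N) V ^+ size s)%:E * law P (Y 0%N) A)%E.
Proof.
move=> /[dup] us /andP[is_ us'] mV mA.
pose W j := if j == i then A else V.
have -> : Y i @^-1` A `&` \big[setI/setT]_(j <- s) (Y j @^-1` V) =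
          \big[setI/setT]_(j <- i :: s) (Y j @^-1` W j).
  rewrite big_cons /W eqxx; congr (_ `&` _); apply: eq_big_seq => j js.
  by case: eqP => // ji; rewrite -ji js in is_.
rewrite iid_prod//; last by move=> j; rewrite /W; case: ifP.
rewrite big_cons {1}/W eqxx EFinM muleC -mass_fin//; congr (_%:E * _)%E.
rewrite (@eq_big_seq _ _ _ _ _ _ (fun=> mass P (Y 0%N) V)); last first.
  by move=> j js; rewrite /W; case: eqP => // ji; rewrite -ji js in is_.
by rewrite big_const_seq count_predT -Monoid.iteropE.
Qed.

(** Restrict [P] to the event that the points indexed by [s] lie in [V] and push forward by [Y i]:
    by [iid_restrict] this is a constant multiple of the common law, and the constant comes out of
    the integral. *)
Lemma iid_integral_restrict (g : T -> R) i (s : seq nat) (V J : set T) :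
  measurable_fun setT g -> (forall z, 0 <= g z) -> uniq (i :: s) ->
  measurable V -> measurable J ->
  (\int[P]_(w in Y i @^-1` J `&` \big[setI/setT]_(j <- s) (Y j @^-1` V))
     (g (Y i w))%:E
   <= (mass P (Y 0%N) V ^+ size s)%:E *
      \int[P]_(w in Y 0%N @^-1` J) (g (Y 0%N w))%:E)%E.
Proof.
move=> mg g0 us mV mJ.
set Q := \big[setI/setT]_(j <- s) _.
have mQ : measurable Q.
  by apply: bigsetI_measurable => j _; exact: preimage_measurable.
have mYJ : measurable (Y i @^-1` J) by exact: preimage_measurable.
have mgJ : measurable_fun J (EFin \o g).
  by apply: measurable_funTS; exact/measurable_EFinP.
have gJ0 : {in J, forall z, (0 <= (EFin \o g) z)%E} by move=> z _; rewrite lee_fin.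
have mgY : measurable_fun (Y i @^-1` J) (EFin \o (g \o Y i)).
  exact: measurable_pmean.
rewrite (@eq_measure_integral _ _ _ _ (mrestr P mQ)); last first.
  by move=> A mA AQ; rewrite /= /mrestr setIidl// => w /AQ[].
have c0 : 0 <= mass P (Y 0%N) V ^+ size s by rewrite exprn_ge0// mass_ge0.
apply: (@le_trans _ _ (\int[mrestr P mQ]_(w in Y i @^-1` J) (g (Y i w))%:E)%E).
  apply: ge0_subset_integral => //; first exact: measurableI.
  by move=> w _; rewrite lee_fin.
rewrite -(ge0_integral_pushforward (mY i) (mrestr P mQ) mJ mgJ gJ0).
rewrite -(ge0_integral_pushforward (mY 0%N) P mJ mgJ gJ0).
have := ge0_integral_mscale (pushforward P (Y 0%N)) mJ (NngNum c0) mgJ.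
move=> /= <-; last by move=> z _; rewrite lee_fin.
rewrite le_eqVlt; apply/orP; left; apply/eqP.
apply: eq_measure_integral => A mA _.
by rewrite /= /pushforward /mrestr /mscale/= iid_restrict.
Qed.

(** * The nearest neighbor as a minimizer of [rho] *)

Context (rho : T -> R) (m : nat) (N : Omega -> T).
Hypothesis mN : measurable_fun setT N.
Hypothesis N_sample : forall w, exists2 i, (1 <= i <= m)%N & N w = Y i w.
Hypothesis N_min :
  forall w j, (1 <= j <= m)%N -> rho (N w) <= rho (Y j w).

(** Stated without a radius, so that closed balls, open balls and the empty set at the foot of the
    ladder are treated alike. *)
Definition rho_ball (B : set T) :=
  measurable B /\ forall y z, B y -> rho z <= rho y -> B z.

(** The minimizer avoids [B] exactly when all [m] sample points do; independence gives the power. *)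
Lemma nn_massC B : rho_ball B -> mass P N (~` B) = mass P (Y 0%N) (~` B) ^+ m.
Proof.
move=> [mB dB]; apply: EFin_inj; have mCB := measurableC mB.
have -> : mass P (Y 0%N) (~` B) ^+ m = mass P (Y 0%N) (~` B) ^+ size (iota 1 m).
  by rewrite size_iota.
rewrite -mass_fin// -iid_pow ?iota_uniq// /law; congr (P _).
rewrite -bigcap_seq; apply/seteqP; split => [w NB j|w QB NB].
  rewrite /= mem_iota add1n ltnS => jm YB; apply: NB.
  by apply: dB YB _; exact: N_min.
have [i im Ni] := N_sample w.
by apply: (QB i); rewrite /= ?mem_iota ?add1n ?ltnS// -Ni.
Qed.

(** A union bound over the index with [N = Y i]: when [N] is in [J], every other point lies outside
    [B], since a point in [B] would force [N] into [B]. The bound is pointwise in [w], so no index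
    has to be selected measurably. *)
Lemma nn_pmean_le (g : T -> R) (K : R) (B J : set T) :
  measurable_fun setT g -> (forall z, 0 <= g z) -> (forall z, g z <= K) ->
  rho_ball B -> measurable J -> J `&` B = set0 ->
  pmean P N g J <=
    m%:R * mass P (Y 0%N) (~` B) ^+ m.-1 * pmean P (Y 0%N) g J.
Proof.
move=> mg g0 gK [mB dB] mJ JB; have mCB := measurableC mB.
pose Q i := \big[setI/setT]_(j <- rem i (iota 1 m)) (Y j @^-1` (~` B)).
pose D i := Y i @^-1` J `&` Q i.
have mQ i : measurable (Q i).
  by apply: bigsetI_measurable => j _; exact: preimage_measurable.
have mD i : measurable (D i) by apply: measurableI => //; exact: preimage_measurable.
pose F i := (EFin \o (g \o Y i)) \_ (D i).
have F0 i w : (0 <= F i w)%E.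
  by apply: erestrict_ge0 => v _; rewrite lee_fin /=.
have mF i : measurable_fun setT (F i).
  by apply/(measurable_restrictT _ (mD i)); exact: measurable_pmean.
rewrite -lee_fin -(pmean_fin _ _ _ _ mN mg g0 gK _ mJ).
apply: (@le_trans _ _ (\int[P]_w (\sum_(i <- iota 1 m) F i w))%E).
  rewrite integral_mkcond; apply: ge0_le_integral => //.
  - by move=> w _; apply: erestrict_ge0 => v _; rewrite lee_fin /=.
  - apply/(measurable_restrictT _ (preimage_measurable _ _ mN mJ)).
    exact: measurable_pmean.
  - exact: emeasurable_sum.
  move=> w _; rewrite patchE; case: ifPn => [|_]; last exact: sume_ge0.
  rewrite inE /= => NJ; have [i im Ni] := N_sample w.
  have i_iota : i \in iota 1 m by rewrite mem_iota add1n ltnS.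
  rewrite (big_rem _ i_iota)/= -[leLHS]adde0; apply: leeD; last exact: sume_ge0.
  rewrite /F patchE mem_set/= ?Ni//; split; first by rewrite /= -Ni.
  rewrite /Q -bigcap_seq => j /=  /mem_rem; rewrite mem_iota add1n ltnS => jm YB.
  have : (J `&` B) (N w) by split => //; apply: dB YB _; exact: N_min.
  by rewrite JB.
rewrite ge0_integral_sum//.
set h := mass P (Y 0%N) (~` B).
apply: (@le_trans _ _ (\sum_(i <- iota 1 m) (h ^+ m.-1 * pmean P (Y 0%N) g J)%:E)%E).
  rewrite big_seq [leRHS]big_seq; apply: lee_sum => i im.
  rewrite -integral_mkcond EFinM -(pmean_fin _ _ _ _ (mY 0%N) mg g0 gK _ mJ).
  rewrite -[in m.-1](size_iota 1 m) -(size_rem im).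
  apply: iid_integral_restrict => //=.
  by rewrite rem_uniq ?iota_uniq// mem_rem_uniq ?iota_uniq// inE eqxx.
rewrite sumEFin lee_fin big_const_seq count_predT size_iota.
by rewrite iter_addr addr0 -[leLHS]mulr_natl mulrA.
Qed.

(** * The ladder invariant and the two kinds of shells *)

Context (g : T -> R) (K : R).
Hypotheses (mg : measurable_fun setT g) (g0 : forall z, 0 <= g z)
  (gK : forall z, g z <= K).

Local Notation f := (mass P (Y 0%N)).
Local Notation e := (pmean P (Y 0%N) g).
Local Notation E := (pmean P N g).

(** The bound [E B <= C * eps * P(N in B)] strengthened by the boundary term of the summation by
    parts; its weight involves the derivative of [t^m] at [1 - f B]. *)
Definition ladder_inv (C eps : R) (B : set T) : Prop :=
  E B + C * (m%:R * (1 - f B) ^+ m.-1) * (eps * f B - e B)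
    <= C * eps * (1 - (1 - f B) ^+ m).

Let f_le1 B : rho_ball B -> f B <= 1.
Proof. by case=> mB _; exact: mass_le1. Qed.

Lemma ladder_inv_step C eps B B' : 0 <= C -> 0 <= eps ->
  rho_ball B -> rho_ball B' -> B `<=` B' ->
  e B <= eps * f B -> e B' <= eps * f B' ->
  E (B' `\` B) <= C * slope m (1 - f B) (1 - f B') * e (B' `\` B) ->
  ladder_inv C eps B -> ladder_inv C eps B'.
Proof.
move=> C0 eps0 bB bB' BB' eB eB' EJ inv.
have [[mB _] [mB' _]] := (bB, bB').
have fD := massD P _ _ _ (mY 0%N) mB mB' BB'.
have eD := pmeanD P _ _ _ (mY 0%N) mg g0 gK _ _ mB mB' BB'.
have ED := pmeanD P _ _ _ mN mg g0 gK _ _ mB mB' BB'.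
rewrite /ladder_inv ED eD fD; apply: ladder_step => //.
- exact: mass_ge0.
- by rewrite -fD f_le1.
- by rewrite -fD -eD.
- by rewrite -fD.
Qed.

(** The union bound has the factor [m (1 - f B)^(m-1)]; on a shell this thin it exceeds the slope by
    at most [expR 1], which [C] absorbs. *)
Lemma ladder_inv_small C eps B B' : expR 1 <= C -> 0 <= eps ->
  rho_ball B -> rho_ball B' -> B `<=` B' ->
  e B <= eps * f B -> e B' <= eps * f B' ->
  f (B' `\` B) <= (1 - f B') / m%:R ->
  ladder_inv C eps B -> ladder_inv C eps B'.
Proof.
move=> eC eps0 bB bB' BB' eB eB' fJ.
have [[mB _] [mB' _]] := (bB, bB').
have C0 : 0 <= C by apply: le_trans eC; exact: expR_ge0.
have fD := massD P _ _ _ (mY 0%N) mB mB' BB'.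
have mJ := measurableD mB' mB.
apply: ladder_inv_step => //.
have JB : (B' `\` B) `&` B = set0 by rewrite setIC setDIK.
apply: (le_trans (nn_pmean_le _ _ _ _ mg g0 gK bB mJ JB)).
apply: ler_wpM2r; first exact: pmean_ge0.
have fB' := f_le1 _ bB'.
have fBB' : f B <= f B' by rewrite fD lerDl mass_ge0.
rewrite massC//; apply: (@le_trans _ _ (expR 1 * slope m (1 - f B) (1 - f B'))).
  apply: slope_ge_small_gap; rewrite ?subr_ge0 ?lerB//.
  by apply: le_trans fJ; rewrite fD; lra.
apply: ler_wpM2r => //; apply: le_trans (slope_ge _ _ _ _ _).
- by rewrite mulr_ge0// exprn_ge0// subr_ge0.
- by rewrite subr_ge0.
- exact: lerB.
Qed.

(** By [nn_massC] the mass of [N] on the shell is [f] of the shell times the slope, so clearing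
    denominators in condition (B) yields the estimate with the slope. *)
Lemma ladder_inv_atom C eps B B' : 0 <= C -> 0 <= eps ->
  rho_ball B -> rho_ball B' -> B `<=` B' ->
  e B <= eps * f B -> e B' <= eps * f B' ->
  0 < f (B' `\` B) ->
  E (B' `\` B) / mass P N (B' `\` B) <= C * (e (B' `\` B) / f (B' `\` B)) ->
  ladder_inv C eps B -> ladder_inv C eps B'.
Proof.
move=> C0 eps0 bB bB' BB' eB eB' fJ condB.
have [[mB _] [mB' _]] := (bB, bB').
have fD := massD P _ _ _ (mY 0%N) mB mB' BB'.
have nD := massD P _ _ _ mN mB mB' BB'.
have mJ := measurableD mB' mB.
have nJ : mass P N (B' `\` B) = f (B' `\` B) * slope m (1 - f B) (1 - f B').
  have := nn_massC _ bB; have := nn_massC _ bB'; rewrite !massC// => nB' nB.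
  have -> : f (B' `\` B) = (1 - f B) - (1 - f B') by rewrite fD; lra.
  by rewrite -slopeE -nB -nB' nD; lra.
have W0 : 0 <= slope m (1 - f B) (1 - f B').
  by rewrite -(pmulr_rge0 _ fJ) -nJ mass_ge0.
apply: ladder_inv_step => //.
(* For zero mass the quotient in [condB] is 0 by convention and carries no information, but the
   partial mean over a null event vanishes. *)
have [n0|n0] := eqVneq (mass P N (B' `\` B)) 0.
  by rewrite (pmean_eq0 P _ _ _ mN mg g0 gK _ mJ n0) !mulr_ge0// pmean_ge0.
have n_gt0 : 0 < mass P N (B' `\` B) by rewrite lt_def n0 mass_ge0.
move: condB; rewrite ler_pdivrMr// nJ => /le_trans; apply.
rewrite le_eqVlt; apply/orP; left; apply/eqP; field.
by rewrite gt_eqF.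
Qed.

(** * Thin annuli from continuity of the measure *)

Hypothesis mrho_le : forall r, measurable [set z | rho z <= r].
Hypothesis mrho_lt : forall r, measurable [set z | rho z < r].

Local Notation cb r := [set z | rho z <= r].
Local Notation ob r := [set z | rho z < r].

Lemma rho_ball_cb r : rho_ball (cb r).
Proof. by split => // y z /= yr /le_trans; apply. Qed.

Lemma rho_ball_ob r : rho_ball (ob r).
Proof. by split => // y z /= yr /le_lt_trans; apply. Qed.

Lemma mass_nonincreasing_lt (F : nat -> set T) (t : R) :
  (forall n, measurable (F n)) -> (forall n k, (n <= k)%N -> F k `<=` F n) ->
  \bigcap_n F n = set0 -> 0 < t -> exists n, f (F n) < t.
Proof.
move=> mF decF F0 t0.
have mYF n : measurable (Y 0%N @^-1` F n) by exact: preimage_measurable.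
have cap0 : \bigcap_n (Y 0%N @^-1` F n) = set0.
  by rewrite -preimage_bigcap F0 preimage_set0.
have := @nonincreasing_cvg_mu _ _ _ P (fun n => Y 0%N @^-1` F n).
rewrite cap0 measure0 => /(_ _ mYF measurable0) cvgF.
have {}cvgF : (P \o (fun n => Y 0%N @^-1` F n)) n @[n --> \oo] --> 0%E.
  apply: cvgF.
    by rewrite (le_lt_trans (probability_le1 P _))// ltry.
  by move=> n k nk; apply/subsetPset => w; exact: (decF _ _ nk).
have /fine_cvgP[_ /cvgr_lt/(_ _ t0)] := cvgF.
by move=> [n _ /(_ n (leqnn n))] /= ?; exists n.
Qed.

(** The sphere of radius [s] is left out, so the annuli decrease to the empty set even when that
    sphere has positive mass. *)
Lemma annulus_left s t : 0 < t -> exists2 r, r < s & f (ob s `\` cb r) < t.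
Proof.
move=> t0.
have [n|n k nk z [zs /= /negP zn]||//|n] :=
    @mass_nonincreasing_lt (fun n => ob s `\` cb (s - n.+1%:R^-1)) t.
- exact: measurableD.
- split => //=; apply/negP; move: zn; rewrite -!ltNge; apply: le_lt_trans.
  by rewrite lerB// lef_pV2 ?posrE// ler_nat.
- rewrite -subset0 => z zF; have [zs _] := zF 0%N I.
  have [n nz] := ltr_add_invr zs; have [_ /negP] := zF n I.
  by rewrite -ltNge ltrBlDr ltNge ltW.
- by exists (s - n.+1%:R^-1) => //; rewrite ltrBlDr ltrDl invr_gt0.
Qed.

Lemma annulus_right s t : 0 < t -> exists2 r, s < r & f (cb r `\` cb s) < t.
Proof.
move=> t0.
have [n|n k nk z [zs zn]||//|n] :=
    @mass_nonincreasing_lt (fun n => cb (s + n.+1%:R^-1) `\` cb s) t.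
- exact: measurableD.
- split => //=; apply: (le_trans zs).
  by rewrite lerD2l lef_pV2 ?posrE// ler_nat.
- rewrite -subset0 => z zF; have [_ /negP] := zF 0%N I.
  rewrite -ltNge => zs; have [n nz] := ltr_add_invr zs; have [/= zn _] := zF n I.
  by move: nz; rewrite ltNge zn.
- by exists (s + n.+1%:R^-1) => //; rewrite ltrDl invr_gt0.
Qed.

Lemma le_mass A B : measurable A -> measurable B -> A `<=` B -> f A <= f B.
Proof.
by move=> mA mB AB; rewrite (massD P _ _ _ (mY 0%N) mA mB AB) lerDl mass_ge0.
Qed.

Let K_ge0 : 0 <= K.
Proof. exact: le_trans (g0 point) (gK point). Qed.

(** * Real induction on the radius *)

Section real_induction.
Context (C eps delta : R).
Hypotheses (eC : expR 1 <= C) (eps0 : 0 <= eps) (delta0 : 0 <= delta).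
Hypothesis m_gt0 : (0 < m)%N.
Hypothesis g_center : forall z, rho z <= 0 -> g z = 0.
Hypothesis eps_cb : forall r, 0 <= r -> r <= delta -> e (cb r) <= eps * f (cb r).
Hypothesis outside : f (cb delta) < 1.
Hypothesis atoms : forall r, 0 < r -> r <= delta ->
  0 < f [set z | rho z = r] ->
  E [set z | rho z = r] / mass P N [set z | rho z = r] <=
  C * (e [set z | rho z = r] / f [set z | rho z = r]).

Let C0 : 0 <= C.
Proof. by apply: le_trans eC; exact: expR_ge0. Qed.

(** A single mass threshold that makes a shell small for [ladder_inv_small] at every radius up to
    [delta]. *)
Let gap : R := (1 - f (cb delta)) / m%:R.

Let gap_gt0 : 0 < gap.
Proof. by rewrite divr_gt0// ?subr_gt0// ltr0n. Qed.

Let gap_le B : measurable B -> B `<=` cb delta -> gap <= (1 - f B) / m%:R.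
Proof. by move=> mB Bd; rewrite ler_wpM2r// lerB// le_mass. Qed.

(** The open ball is approximated from inside by closed balls, up to an annulus of arbitrarily small
    mass. *)
Lemma eps_ob s : 0 < s -> s <= delta -> e (ob s) <= eps * f (ob s).
Proof.
move=> s0 sd; apply/ler_addgt0Pr => t t0.
(* The annulus contributes at most [K * (t / (K + 1)) <= t]; adding 1 covers [K = 0]. *)
have t'0 : 0 < t / (K + 1) by rewrite divr_gt0// ltr_wpDl.
have [r rs fr] := annulus_left s _ t'0.
(* The inner radius may be negative, whereas [eps_cb] starts at 0. *)
pose r' := Num.max 0 r.
have r'0 : 0 <= r' by rewrite le_max lexx.
have r's : r' < s by rewrite gt_max s0.
have mA r1 : measurable (ob s `\` cb r1) by exact: measurableD.
have sub : cb r' `<=` ob s by move=> z /= /le_lt_trans; apply.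
have fr' : f (ob s `\` cb r') < t / (K + 1).
  apply: le_lt_trans fr; apply: le_mass => // z [zs /= zr]; split => //= zr'.
  by apply: zr; rewrite le_max zr' orbT.
rewrite (pmeanD P _ _ _ (mY 0%N) mg g0 gK _ _ (mrho_le r') (mrho_lt s) sub).
apply: lerD.
  apply: le_trans (eps_cb _ r'0 (ltW (lt_le_trans r's sd))) _.
  by rewrite ler_wpM2l// le_mass.
apply: le_trans (pmean_le_mass P _ _ _ (mY 0%N) mg g0 gK _ (mA r')) _.
apply: (@le_trans _ _ (K * (t / (K + 1)))); first by rewrite ler_wpM2l// ltW.
by rewrite mulrA ler_pdivrMr ?ltr_wpDl//; nra.
Qed.

(** One step up from the empty set: [g] vanishes at the center, so this shell contributes
    nothing. *)
Let ladder_inv0 : ladder_inv C eps (cb 0).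
Proof.
have center0 Z : pmean P Z g (cb 0) = 0.
  by rewrite /pmean integral0_eq// => w /= w0; rewrite g_center.
have b0 : rho_ball set0 by split.
have e0 : e set0 = 0 by apply: (pmean_eq0 P _ _ K) => //; exact: mass0.
have E0 : E set0 = 0 by apply: (pmean_eq0 P _ _ K) => //; exact: mass0.
apply: (ladder_inv_step _ _ set0) => //.
- exact: rho_ball_cb.
- by rewrite e0 mass0 mulr0.
- exact: eps_cb.
- by rewrite setD0 !center0 mulr0.
- by rewrite /ladder_inv E0 e0 mass0 !(mulr0, subr0, addr0, expr1n, subrr).
Qed.

(** Two shells: the thin open annulus up to [ob s], then the sphere of radius [s], which either has
    positive mass and falls under [atoms], or is null and hence small. *)
Let ladder_inv_left r s : 0 <= r -> r < s -> s <= delta ->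
  f (ob s `\` cb r) < gap -> ladder_inv C eps (cb r) -> ladder_inv C eps (cb s).
Proof.
move=> r0 rs sd fJ inv; have s0 := le_lt_trans r0 rs.
have inv_ob : ladder_inv C eps (ob s).
  apply: ladder_inv_small inv => //.
  - exact: rho_ball_cb.
  - exact: rho_ball_ob.
  - by move=> z /= /le_lt_trans; apply.
  - by apply: eps_cb => //; exact: ltW (lt_le_trans rs sd).
  - exact: eps_ob.
  - apply: le_trans (ltW fJ) _; apply: gap_le => // z /= zs.
    exact: ltW (lt_le_trans zs sd).
have sphereE : cb s `\` ob s = [set z | rho z = s].
  apply/seteqP; split => z /=.
    by move=> [zs /negP]; rewrite -leNgt => sz; apply/eqP; rewrite eq_le zs.
  by move=> ->; rewrite lexx ltxx.
have os_cs : ob s `<=` cb s by move=> z /= /ltW.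
have eps_s : e (cb s) <= eps * f (cb s) by apply: eps_cb => //; exact: ltW.
have [fS|fS] := ltP 0 (f (cb s `\` ob s)).
  apply: ladder_inv_atom inv_ob => //.
  - exact: rho_ball_ob.
  - exact: rho_ball_cb.
  - exact: eps_ob.
  - by move: fS; rewrite sphereE; exact: atoms.
apply: ladder_inv_small inv_ob => //.
- exact: rho_ball_ob.
- exact: rho_ball_cb.
- exact: eps_ob.
- apply: (le_trans fS); apply: (le_trans (ltW gap_gt0)); apply: gap_le => // z.
  by move=> /= /le_trans; apply.
Qed.

(** The supremum of the good radii is itself good, by a step from the left, and a step to the right
    would pass it if it were below [delta]. *)
Lemma ladder_inv_delta : ladder_inv C eps (cb delta).
Proof.
pose G := [set r | [/\ 0 <= r, r <= delta & ladder_inv C eps (cb r)]].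
have G0 : G 0 by split.
have supG : has_sup G by split; [exists 0 | exists delta => r []].
have sup0 : 0 <= sup G by apply: ub_le_sup G0; exact: supG.2.
have supd : sup G <= delta by apply: ge_sup => [|r []//]; exists 0.
have invs : ladder_inv C eps (cb (sup G)).
  (* Any good radius beyond [r1] is separated from the supremum by a shell of mass below [gap]. *)
  have [r1 r1s fr1] := annulus_left (sup G) _ gap_gt0.
  have eta0 : 0 < sup G - r1 by rewrite subr_gt0.
  have [r Gr] := sup_adherent eta0 supG; rewrite subKr => r1r.
  have [r0 rd invr] := Gr.
  have := ub_le_sup supG.2 Gr; rewrite le_eqVlt => /predU1P[<-//|rs].
  apply: ladder_inv_left invr => //; apply: le_lt_trans fr1.
  apply: le_mass; try exact: measurableD.
  by move=> z [zs /= zr]; split => //= zr1; apply: zr; exact: le_trans (ltW r1r).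
move: (supd); rewrite le_eqVlt => /predU1P[<-//|sd].
have [r1 sr1 fr1] := annulus_right (sup G) _ gap_gt0.
pose r := Num.min r1 delta.
have sr : sup G < r by rewrite lt_min sr1.
have rd : r <= delta by rewrite ge_min lexx orbT.
have r0 : 0 <= r by exact: le_trans (ltW sr).
have /(ub_le_sup supG.2) : G r.
  split => //; apply: ladder_inv_small invs => //.
  - exact: rho_ball_cb.
  - exact: rho_ball_cb.
  - by move=> z /= /le_trans; apply; exact: ltW.
  - exact: eps_cb.
  - exact: eps_cb.
  - apply: (@le_trans _ _ gap); last first.
      by apply: gap_le => // z /= /le_trans; apply.
    apply: le_trans (ltW fr1); apply: le_mass; try exact: measurableD.
    by move=> z [zr zs]; split => //=; apply: le_trans zr _; rewrite ge_min lexx.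
by rewrite leNgt sr.
Qed.

(** Inside the ball, drop the nonnegative boundary term of the invariant; outside, use [g <= K] and
    [nn_massC]. *)
Lemma nn_pmean_bound : E setT <= C * eps + K * (1 - f (cb delta)) ^+ m.
Proof.
have mcb : measurable (cb delta) by [].
rewrite (pmeanD P _ _ _ mN mg g0 gK _ _ mcb measurableT (@subsetT _ _)) setTD.
have mC := measurableC mcb; apply: lerD; last first.
  apply: le_trans (pmean_le_mass P _ _ _ mN mg g0 gK _ mC) _.
  by rewrite (nn_massC _ (rho_ball_cb delta)) massC.
have p0 : 0 <= 1 - f (cb delta) by rewrite subr_ge0 ltW.
have := ladder_inv_delta; rewrite /ladder_inv.
have w0 : 0 <= C * (m%:R * (1 - f (cb delta)) ^+ m.-1) *
      (eps * f (cb delta) - e (cb delta)).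
  by rewrite mulr_ge0 ?subr_ge0 ?eps_cb//; rewrite mulr_ge0// mulr_ge0// exprn_ge0.
have : 0 <= C * eps * (1 - f (cb delta)) ^+ m by rewrite !mulr_ge0// exprn_ge0.
by move=> *; lra.
Qed.

End real_induction.
End nearest.

(** * Balls are Borel sets *)

Lemma open_ball_measurable {R : realType} {d : measure_display}
    {T : measurableType d} (dist : T -> T -> R) (x : T) (r : R) :
  is_metric dist -> borel_of_metric dist -> measurable [set z | dist x z < r].
Proof.
move=> [_ [_ [_ tri]]] ->; apply: sub_sigma_algebra => y /= yr.
exists (r - dist x y); rewrite subr_gt0; split => // z /= yz.
by apply: le_lt_trans (tri x y z) _; rewrite -ltrBrDl.
Qed.

Lemma cball_measurable {R : realType} {d : measure_display}
    {T : measurableType d} (dist : T -> T -> R) (x : T) (r : R) :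
  is_metric dist -> borel_of_metric dist -> measurable (cball dist x r).
Proof.
move=> [_ [_ [sym tri]]] bor; rewrite -[cball _ _ _]setCK; apply: measurableC.
rewrite bor; apply: sub_sigma_algebra => y /= /negP; rewrite -ltNge => ry.
exists (dist x y - r); rewrite subr_gt0; split => // z /= yz.
apply/negP; rewrite -ltNge; have := tri x z y; rewrite (sym z y); lra.
Qed.

(** * From the bound at fixed [m] to the limit *)

Theorem mainTheorem10 (R : realType) (d : measure_display) (T : measurableType d)
  (dist : T -> T -> R) (dO : measure_display) (Omega : measurableType dO)
  (P : probability Omega R) (Y : nat -> Omega -> T)
  (x : T) (eta : T -> R) (NN : nat -> Omega -> T) :
  is_metric dist ->
  borel_of_metric dist ->
  iid P Y ->
  in_support P (Y 0%N) dist x ->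
  measurable_fun setT eta ->
  (exists K : R, forall z, `|eta z| <= K) ->
  (forall m, (1 <= m)%N -> measurable_fun setT (NN m)) ->
  (forall m, (1 <= m)%N -> nearest_neighbor dist Y x m (NN m)) ->
  (* condition (B) *)
  (exists (C Rad : R) (M : nat), 0 < C /\ 0 < Rad /\
     forall (r : R) (m : nat), 0 < r -> r < Rad -> (M <= m)%N -> (1 <= m)%N ->
       (0 < law P (Y 0%N) (sphere dist x r))%E ->
       cond_exp P (fun w => `|eta (NN m w) - eta x|) (NN m @^-1` sphere dist x r)
       <= C * cond_exp P (fun w => `|eta (Y 0%N w) - eta x|)
                         (Y 0%N @^-1` sphere dist x r)) ->
  lebesgue_point P (Y 0%N) dist eta x ->
  (fun m : nat => (\int[P]_w (`|eta (NN m w) - eta x|)%:E)%E) @ \oo --> 0%E.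
Proof.
move=> metric_dist bor iidY supp meta [K0 etaK0] mNN nnNN.
move=> [C [Rad [M [C0 [Rad0 condB]]]]] leb.
have [dist_ge0 [dist0 _]] := metric_dist.
have mY0 : measurable_fun setT (Y 0%N) by case: iidY.
pose g (z : T) : R := `|eta z - eta x|.
pose K := K0 + K0.
have mg : measurable_fun setT g.
  by apply: measurableT_comp => //; exact: measurable_funB.
have g0 z : 0 <= g z by exact: normr_ge0.
have gK z : g z <= K by rewrite (le_trans (ler_normB _ _))// lerD.
have g_center z : dist x z <= 0 -> g z = 0.
  move=> xz; have /dist0 <- : dist x z = 0 by apply/eqP; rewrite eq_le xz dist_ge0.
  by rewrite /g subrr normr0.
have mcb r : measurable (cball dist x r) by exact: cball_measurable.
have mob r : measurable [set z | dist x z < r] by exact: open_ball_measurable.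
pose f := mass P (Y 0%N); pose e := pmean P (Y 0%N) g.
suff cvgE : forall eps : R, 0 < eps -> \forall m \near \oo, pmean P (NN m) g setT <= eps.
  apply: (@cvg_trans _ ((fun m => (pmean P (NN m) g setT)%:E) @ \oo)).
    apply: near_eq_cvg; near=> m.
    have m1 : (1 <= m)%N by near: m; exact: nbhs_infty_ge.
    by rewrite -(pmean_fin P _ _ _ (mNN m m1) mg g0 gK)// preimage_setT.
  apply: cvg_EFin; first exact: nearW.
  apply/cvgr0Pnorm_le => eps eps0; near=> m => /=.
  by rewrite ger0_norm ?pmean_ge0//; near: m; exact: cvgE.
move=> eps eps0.
have sphere_f r : 0 < f (sphere dist x r) -> (0 < law P (Y 0%N) (sphere dist x r))%E.
  rewrite /f /mass => fS; rewrite lt_neqAle measure_ge0 andbT eq_sym.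
  by apply/eqP => law0; move: fS; rewrite law0 ltxx.
have f_gt0 r : 0 < r -> 0 < f (cball dist x r).
  by move=> r0; rewrite -lte_fin -mass_fin//; exact: supp.
(* The Lebesgue condition with the denominator cleared; it then extends to radius 0, where [g]
   vanishes and the mass may be 0. *)
have lebP (t : R) : 0 < t -> exists2 r0, 0 < r0 &
    forall r, 0 <= r -> r < r0 -> e (cball dist x r) <= t * f (cball dist x r).
  move=> t0; have [r0 /= r0_gt0 r0P] := cvgr_lt _ leb _ t0.
  exists r0 => // r; rewrite le_eqVlt => /predU1P[<- _|r_gt0 rr0].
    rewrite /e /pmean integral0_eq; last by move=> w /= /g_center; rewrite /g => ->.
    by rewrite mulr_ge0 ?mass_ge0// ltW.
  rewrite -ler_pdivrMr ?f_gt0// ltW//; apply: r0P => //=.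
  by rewrite sub0r normrN gtr0_norm.
(* If no ball has mass below 1, then [g] has mean zero under the common law, and the union bound
   with the empty ball gives the same for the neighbor. *)
have [[del0 del0_gt0 f_lt1]|f_ge1] :=
    pselect (exists2 del : R, 0 < del & f (cball dist x del) < 1); last first.
  have e0 : e setT <= 0.
    apply/ler_addgt0Pr => t t0; have [r0 r0_gt0 er0] := lebP t t0.
    have r2 : 0 < r0 / 2 by rewrite divr_gt0.
    have f1 : f (cball dist x (r0 / 2)) = 1.
      apply/eqP; rewrite eq_le mass_le1// leNgt.
      by apply/negP => lt1; apply: f_ge1; exists (r0 / 2).
    have mC := measurableC (mcb (r0 / 2)).
    have mB := mcb (r0 / 2).
    rewrite /e (pmeanD P _ _ _ mY0 mg g0 gK _ _ mB measurableT (@subsetT _ _)).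
    rewrite setTD (pmean_eq0 P _ _ _ mY0 mg g0 gK _ mC) ?addr0 ?add0r; last first.
      by rewrite massC// -/f f1 subrr.
    by have := er0 _ (ltW r2); rewrite f1 mulr1; apply; lra.
  near=> m; have m1 : (1 <= m)%N by near: m; exact: nbhs_infty_ge.
  have ball0 : rho_ball (dist x) set0 by split.
  apply: le_trans (nn_pmean_le P _ iidY (dist x) m _ (mNN m m1) _ _ g K set0 setT
    mg g0 gK ball0 measurableT _) _.
  - by move=> w; have [] := nnNN m m1 w.
  - by move=> w; have [] := nnNN m m1 w.
  - by rewrite setI0.
  by apply: le_trans (ltW eps0); rewrite mulr_ge0_le0// mulr_ge0// exprn_ge0// mass_ge0.
(* Thin shells need a constant of at least [expR 1]; enlarging [C] keeps condition (B), as its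
   right-hand mean is nonnegative. *)
pose C' := Num.max C (expR 1).
have eC' : expR 1 <= C' by rewrite le_max lexx orbT.
have CC' : C <= C' by rewrite le_max lexx.
have C'0 : 0 < C' by apply: lt_le_trans CC'.
pose t := eps / 2 / C'.
have t0 : 0 < t by rewrite !divr_gt0.
have [r0 r0_gt0 er0] := lebP t t0.
(* Halving gives the strict inequalities [del < r0] and [del < Rad]. *)
pose del := Num.min del0 (Num.min (r0 / 2) (Rad / 2)).
have del_gt0 : 0 < del by rewrite !lt_min del0_gt0 !divr_gt0.
have [del_del0 [del_r0 del_Rad]] : del <= del0 /\ del < r0 /\ del < Rad.
  rewrite /del !minElt; do ! case: ifPn => //; rewrite -?leNgt; lra.
have f_del : f (cball dist x del) < 1.
  apply: le_lt_trans f_lt1; apply: le_mass => // z /= /le_trans; exact.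
(* The support condition enters here: a ball of positive mass makes the outer term decay
   geometrically. *)
have q1 : `|1 - f (cball dist x del)| < 1.
  have := f_gt0 _ del_gt0; rewrite ger0_norm; lra.
have cvgK := cvg_geometric K q1.
have eps2 : 0 < eps / 2 by rewrite divr_gt0.
have nearK := cvgr_le _ cvgK _ eps2.
near=> m.
have m1 : (1 <= m)%N by near: m; exact: nbhs_infty_ge.
have mM : (M <= m)%N by near: m; exact: nbhs_infty_ge.
have Km : K * (1 - f (cball dist x del)) ^+ m <= eps / 2 by near: m; exact: nearK.
apply: (@le_trans _ _ (C' * t + K * (1 - f (cball dist x del)) ^+ m)); last first.
  have -> : C' * t = eps / 2 by rewrite /t mulrC divfK// gt_eqF.
  lra.
apply: (nn_pmean_bound P _ iidY (dist x) m _ (mNN m m1) _ _ g K mg g0 gK mcb mob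
  C' t del) => //.
- by move=> w; have [] := nnNN m m1 w.
- by move=> w; have [] := nnNN m m1 w.
- exact: ltW.
- exact: ltW.
- by move=> r r_ge0 r_del; apply: er0 => //; exact: le_lt_trans del_r0.
- move=> r r_gt0 r_del fS.
  have r_Rad := le_lt_trans r_del del_Rad.
  apply: le_trans (condB r m r_gt0 r_Rad mM m1 (sphere_f _ fS)) _.
  apply: ler_wpM2r => //; have := pmean_ge0 P (Y 0%N) g g0 (sphere dist x r).
  by move=> /divr_ge0; apply; exact: mass_ge0.
Unshelve. all: by end_near.
Qed.
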